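(* Let $d\ge 2$, and let $c=c_1/c_2$ with $c_1\in\mathbb{Z}$ and $c_2\in\mathbb{Z}^+$ relatively prime. Let $u_1/u_2\in\mathbb{Q}$ be a periodic point of $x^d+c$ of exact period $n>1$, where $u_1,u_2$ are relatively prime integers. If there is a prime $p$ such that $p\mid c_1$ and $\gcd(p,d^n-1)=1$, then $\gcd(p-1,d^n-1)>1$. In fact, if $d^n-1$ is prime, then $p\equiv 1 \bmod (d^n-1)$; in particular, $p>d^n$.
   Context: For $f(x)=x^d+c$, with iterates $f^1=f$ and $f^m=f\circ f^{m-1}$, a point $u\in\mathbb{Q}$ is a periodic point of exact period $n$ if $n$ is the smallest positive integer with $f^n(u)=u$. *)

(* Defs.v *)
From mathcomp Require Import all_boot all_order all_algebra.

Set Implicit Arguments.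
Unset Strict Implicit.
Unset Printing Implicit Defensive.

Import GRing.Theory.
Local Open Scope ring_scope.

Definition unicritical (R : nzRingType) (d : nat) (c : R) (x : R) : R :=
  x ^+ d + c.

Definition exact_period (T : Type) (f : T -> T) (u : T) (n : nat) : Prop :=
  [/\ (0 < n)%N,
      iter n f u = u
    & forall m : nat, (0 < m)%N -> iter m f u = u -> (n <= m)%N].

(* Main.v *)
Require Import Defs.
From mathcomp Require Import all_boot all_order all_algebra all_field.
From mathcomp Require Import ring.

Set Implicit Arguments.
Unset Strict Implicit.
Unset Printing Implicit Defensive.

Import Order.TTheory GRing.Theory Num.Theory.
Local Open Scope ring_scope.

(** The proof reduces the whole cycle [x_i = f^i(u)] modulo [p].

    Since [p] divides [c1], the map [f] reduces to [x |-> x^d], and a periodic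
    point has no [p] in its denominator because [f^i(u)] behaves like
    [u^(d^i)] when [u] is [p]-adically large
    ([periodic_integral]).  So [u] reduces to some [a] in
    ['F_p] with [a^(d^n) = a].

    If the reduction [a] is itself fixed by [x |-> x^d], all points of the
    cycle are congruent to [a], and each difference quotient
    [(f x_(i+1) - f x_i) / (x_(i+1) - x_i)] reduces to the derivative
    [d a^(d-1)].  The product of these quotients around the cycle
    telescopes to [1], whence [(d a^(d-1))^n = 1] ([cycle_multiplier]).  Both
    [0] and [1] are fixed by [x |-> x^d]: for [a = 0] the derivative vanishes,
    so its power is not [1]; for [a = 1] the relation reads [d^n = 1] in
    ['F_p], contrary to [p] not dividing [d^n - 1].

    Therefore [a != 0] and [a != 1], while [a] is killed by both exponents
    [d^n - 1] and [p - 1] (Fermat): these cannot be coprime.  When [d^n - 1] is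
    prime it must then divide [p - 1], and [p = d^n] is impossible since
    [n > 1]. *)

Section Reduction.

Variable F : fieldType.
Implicit Types (x y : rat) (a b : F).

(** The reduction homomorphism from the rationals whose denominator is
    invertible in [F] to [F], given by its graph: no representative has to be
    in lowest terms, and integrality of [x] is the existence of [a]. *)
Definition reduces x a :=
  exists m k : int, [/\ k%:~R != 0 :> F, x * k%:~R = m%:~R & a * k%:~R = m%:~R].

Lemma reduces_int (m : int) : reduces m%:~R m%:~R.
Proof. by exists m, 1; rewrite !mulr1z !mulr1 oner_neq0. Qed.

Lemma reduces_frac (m k : int) :
  k%:~R != 0 :> F -> reduces (m%:~R / k%:~R) (m%:~R / k%:~R).
Proof.
move=> k0; exists m, k; split=> //; last by rewrite divfK.
rewrite divfK //; apply: contraNneq k0 => /eqP.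
by rewrite intr_eq0 => /eqP ->; rewrite mulr0z.
Qed.

Lemma reduces1 : reduces 1 1.
Proof. exact: (reduces_int 1). Qed.

Lemma reducesD x y a b : reduces x a -> reduces y b -> reduces (x + y) (a + b).
Proof.
move=> [m [k [k0 xk ak]]] [r [l [l0 yl bl]]].
exists (m * l + r * k), (k * l).
rewrite !rmorphD !rmorphM /= mulf_neq0 // -xk -yl -ak -bl.
by split=> //; ring.
Qed.

Lemma reducesM x y a b : reduces x a -> reduces y b -> reduces (x * y) (a * b).
Proof.
move=> [m [k [k0 xk ak]]] [r [l [l0 yl bl]]].
exists (m * r), (k * l).
rewrite !rmorphM /= mulf_neq0 // -xk -yl -ak -bl.
by split=> //; ring.
Qed.

Lemma reducesX x a i : reduces x a -> reduces (x ^+ i) (a ^+ i).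
Proof.
by move=> xa; elim: i => [|i IH]; [exact: reduces1|rewrite !exprS; exact: reducesM].
Qed.

Lemma reduces_sum (I : Type) (r : seq I) (x : I -> rat) (a : I -> F) :
  (forall i, reduces (x i) (a i)) ->
  reduces (\sum_(i <- r) x i) (\sum_(i <- r) a i).
Proof.
move=> xa; elim/big_rec2: _ => [|i y b _]; first exact: (reduces_int 0).
exact: reducesD.
Qed.

Lemma reduces_unique x a b : reduces x a -> reduces x b -> a = b.
Proof.
move=> xa xb; have: reduces (x + (-1)%:~R * x) (a + (-1)%:~R * b).
  by apply: reducesD => //; apply: reducesM => //; exact: reduces_int.
rewrite !mulrN1z !mulN1r subrr => -[m [k [k0 m0 mF]]].
move: m0; rewrite mul0r => /esym/eqP; rewrite intr_eq0 => /eqP m0.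
move/eqP: mF; rewrite m0 mulr0z mulf_eq0 (negbTE k0) orbF subr_eq0.
by move/eqP.
Qed.

(** If [u^-1] reduces to [0], then [f^i(u) / u^(d^i)] reduces to [1] for every
    [i]; for [i] a period this quotient is a positive power of [u^-1]. *)
Lemma periodic_integral (d n : nat) (c u : rat) :
  (2 <= d)%N -> (0 < n)%N -> reduces c 0 -> u != 0 ->
  iter n (unicritical d c) u = u -> ~ reduces u^-1 0.
Proof.
move=> hd hn c0 u0 hper w0.
have lead i : reduces (iter i (unicritical d c) u * u^-1 ^+ (d ^ i)) 1.
  elim: i => [|i IH]; first by rewrite /= expr1 mulfV //; exact: reduces1.
  rewrite iterS /unicritical mulrDl expnSr exprM -exprMn.
  have := reducesD (reducesX d IH)
    (reducesM c0 (reducesX d (reducesX (d ^ i) w0))).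
  by rewrite expr1n mul0r addr0.
have dn : (1 < d ^ n)%N by rewrite -{1}(exp1n n) ltn_exp2r.
have := lead n; rewrite hper -(prednK (ltnW dn)) exprS mulrA mulfV // mul1r.
move/reduces_unique/(_ (reducesX _ w0))/eqP.
by rewrite expr0n gtn_eqF ?oner_eq0 // -ltnS prednK // ltnW.
Qed.

Lemma reduces_orbit (d : nat) (c u : rat) (a : F) i :
  reduces c 0 -> reduces u a ->
  reduces (iter i (unicritical d c) u) (a ^+ (d ^ i)).
Proof.
move=> c0 ua; elim: i => [|i IH]; first by rewrite expr1.
rewrite iterS /unicritical expnSr exprM -[X in reduces _ X]addr0.
by apply: reducesD => //; exact: reducesX.
Qed.

(** Telescoping of the difference quotients of [f] along a cycle whose points
    all reduce to the same [a]: the multiplier [(f^n)'] reduces to [1]. *)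
Lemma cycle_multiplier (d n : nat) (c u : rat) (a : F) :
  reduces c 0 -> reduces u a -> a ^+ d = a ->
  iter n (unicritical d c) u = u -> unicritical d c u != u ->
  (a ^+ d.-1 *+ d) ^+ n = 1.
Proof.
move=> c0 ua ad hper hne.
pose x i := iter i (unicritical d c) u.
have xa i : reduces (x i) a.
  have := reduces_orbit d i c0 ua; congr (reduces _ _).
  by elim: i => [|i IH]; rewrite ?expr1 // expnSr exprM IH.
have quot i : exists2 q, reduces q ((a ^+ d.-1 *+ d) ^+ i)
    & x i.+1 - x i = (x 1 - x 0) * q.
  elim: i => [|i [q qa xq]]; first by exists 1; rewrite ?mulr1 //; exact: reduces1.
  exists (q * \sum_(j < d) x i.+1 ^+ (d.-1 - j) * x i ^+ j).
    rewrite exprSr; apply: reducesM => //.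
    have -> : a ^+ d.-1 *+ d = \sum_(j < d) a ^+ (d.-1 - j) * a ^+ j.
      rewrite (eq_bigr (fun=> a ^+ d.-1)) ?sumr_const ?card_ord // => j _.
      by rewrite -exprD subnK // -ltnS (ltn_predK (ltn_ord j)).
    by apply: reduces_sum => j; apply: reducesM; apply: reducesX.
  rewrite mulrA -xq -subrXX.
  by rewrite [x i.+2]iterS [X in _ - X]iterS /unicritical -/(x i) -/(x i.+1); ring.
have [q qa] := quot n.
have -> : x n.+1 = x 1 by rewrite [x n.+1]iterS hper.
rewrite [x n]hper [x 0]/= -[LHS]mulr1 => /mulfI.
rewrite subr_eq0 => /(_ hne) q1.
by apply: reduces_unique qa _; rewrite -q1; exact: reduces1.
Qed.

End Reduction.

Lemma expr_coprime1 (F : fieldType) (a : F) (m k : nat) :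
  (0 < m)%N -> coprime m k -> a ^+ m = 1 -> a ^+ k = 1 -> a = 1.
Proof.
move=> m0 /eqP mk am ak; case: (egcdnP k m0) => i j ij _.
have: a ^+ (i * m) = 1 by rewrite mulnC exprM am expr1n.
by rewrite ij mk exprD expr1 mulnC exprM ak expr1n mul1r.
Qed.

Lemma intr_Fp_eq0 (p : nat) (m : int) :
  prime p -> (m%:~R == 0 :> 'F_p) = (p%:Z %| m)%Z.
Proof.
move=> hp; rewrite dvdzE (dvdn_pcharf (pchar_Fp hp)).
by case: m => m; rewrite ?NegzE ?mulrNz ?oppr_eq0 ?abszN.
Qed.

Lemma Fp_fermat (p : nat) (a : 'F_p) : prime p -> a != 0 -> a ^+ (p - 1) = 1.
Proof.
move=> hp a0; apply: (mulfI a0); rewrite mulr1 -exprS subn1.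
rewrite prednK ?prime_gt0 //; have := expf_card a.
by rewrite card_Fp.
Qed.

Theorem corollary5p3 (d n p : nat) (c1 c2 u1 u2 : int)
  (hd : (2 <= d)%N) (hn : (1 < n)%N)
  (hc2 : 0 < c2) (hc : coprimez c1 c2)
  (hu2 : u2 != 0) (hu : coprimez u1 u2)
  (hper : exact_period (unicritical d (c1%:Q / c2%:Q)) (u1%:Q / u2%:Q) n)
  (hp : prime p) (hpc : (p%:Z %| c1)%Z)
  (hgcd : gcdn p (d ^ n - 1) = 1%N) :
  (1 < gcdn (p - 1) (d ^ n - 1))%N /\
  (prime (d ^ n - 1) ->
     p = 1 %[mod d ^ n - 1] /\ (d ^ n < p)%N).
Proof.
set c := c1%:Q / c2%:Q in hper; set u := u1%:Q / u2%:Q in hper.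
have [n0 cyc minn] := hper.
have coprime_ndvd (s t : int) : coprimez s t -> (p%:Z %| s)%Z -> ~~ (p%:Z %| t)%Z.
  move=> st ps; apply/negP => pt.
  have: (p%:Z %| gcdz s t)%Z by rewrite dvdz_gcd ps pt.
  by rewrite (eqP st) dvdz1 /= => /eqP p1; move: hp; rewrite p1.
have c0 : reduces c (0 : 'F_p).
  have -> : 0 = c1%:~R / c2%:~R :> 'F_p.
    by apply/esym/eqP; rewrite mulf_eq0 intr_Fp_eq0 ?hpc.
  by apply: reduces_frac; rewrite intr_Fp_eq0 // (coprime_ndvd c1).
have u2p : u2%:~R != 0 :> 'F_p.
  rewrite intr_Fp_eq0 //; apply/negP => pu2.
  have pu1 : ~~ (p%:Z %| u1)%Z by apply: coprime_ndvd pu2; rewrite coprimez_sym.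
  have u0 : u != 0.
    rewrite mulf_neq0 ?invr_eq0 ?intr_eq0 //.
    by apply: contraNneq pu1 => ->; rewrite dvdz0.
  apply: (periodic_integral hd n0 c0 u0 cyc).
  have -> : 0 = u2%:~R / u1%:~R :> 'F_p.
    by apply/esym/eqP; rewrite mulf_eq0 intr_Fp_eq0 ?pu2.
  by rewrite invf_div; apply: reduces_frac; rewrite intr_Fp_eq0.
pose a : 'F_p := u1%:~R / u2%:~R.
have ua : reduces u a by apply: reduces_frac.
have not_fixed : unicritical d c u != u.
  by apply/eqP => fu; have := minn 1 isT fu; rewrite leqNgt hn.
have mult : a ^+ d = a -> (a ^+ d.-1 *+ d) ^+ n = 1.
  by move=> ad; apply: cycle_multiplier c0 ua ad cyc not_fixed.
have a0 : a != 0.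
  apply/eqP => a0; move: mult; rewrite a0 !expr0n.
  have d1 : (0 < d.-1)%N by rewrite -ltnS prednK // ltnW.
  rewrite (gtn_eqF d1) (gtn_eqF (ltnW hd)) mul0rn expr0n (gtn_eqF n0).
  by move/(_ erefl)/eqP; rewrite eq_sym oner_eq0.
have dn : (1 < d ^ n)%N by rewrite -{1}(exp1n n) ltn_exp2r.
have a1 : a != 1.
  apply/eqP => a1; move: mult; rewrite a1 !expr1n -natrX => /(_ erefl) dn1.
  have: (p %| d ^ n - 1)%N.
    by rewrite (dvdn_pcharf (pchar_Fp hp)) natrB 1?ltnW // dn1 subrr.
  by move/gcdn_idPl; rewrite hgcd => p1; move: hp; rewrite -p1.
have adn : a ^+ (d ^ n - 1) = 1.
  apply: (mulfI a0); rewrite mulr1 -exprS subn1 prednK 1?ltnW //.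
  by have := reduces_orbit d n c0 ua; rewrite cyc => /reduces_unique; apply.
have gt1 : (1 < gcdn (p - 1) (d ^ n - 1))%N.
  have p1 : (0 < p - 1)%N by rewrite subn_gt0 prime_gt1.
  rewrite ltn_neqAle gcdn_gt0 p1 andbT eq_sym; apply: contra a1 => cop.
  by apply/eqP; apply: expr_coprime1 p1 cop (Fp_fermat hp a0) adn.
split=> // pr.
have dvd : (d ^ n - 1 %| p - 1)%N.
  by apply: contraLR gt1; rewrite -prime_coprime // coprime_sym => /eqP ->.
split; first by apply/eqP; rewrite eqn_mod_dvd // prime_gt0.
have p1 : (0 < p - 1)%N by rewrite subn_gt0 prime_gt1.
rewrite ltn_neqAle; apply/andP; split; last first.
  by move: (dvdn_leq p1 dvd); rewrite leq_sub2rE ?prime_gt0.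
apply: contraTneq hp => <-; apply/primePn; right; exists d; last first.
  by rewrite dvdn_exp.
by rewrite hd -{1}(expn1 d) ltn_exp2l.
Qed.
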